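(* The causal theory $\mathsf{HP}_{2005}$ (the 2005 version of Halpern–Pearl causality) does not satisfy the principle of presumption. Specifically, let $\mathcal S$ be the causal structure with exogenous variables $U_1,U_2,U_3$ and endogenous variables $J_1,J_2,J_3,B$, all with range $\{0,1\}$. Let $M$ be the causal model over $\mathcal S$ whose graph has exactly the edges $J_1\to B$, $J_2\to B$, $J_3\to B$, whose equations are $J_1=U_1$, $J_2=U_2$, $J_3=U_3$, and $B=1-\max\{J_1,J_2\}$ if $J_2=J_3$, $B=1$ otherwise, and whose context is $U_1=U_2=U_3=1$. Then for this $M$, $\phi=(B=0)$ and $V=J_1$ the condition in the principle of presumption fails for $\mathsf{Cause}=\mathsf{HP}_{2005}$.
   Context: Causal structure: a tuple $\mathcal S=(\mathcal U,\mathcal V,\mathcal R)$ with $\mathcal U$ a finite set of exogenous variables, $\mathcal V$ a finite set of endogenous variables, and $\mathcal R$ assigning to every variable $X\in\mathcal U\cup\mathcal V$ a finite set $\mathcal R(X)$ of values (its range). Causal model over $\mathcal S$: a tuple $M=(\mathsf G,\mathcal F,\vec u)$ where $\mathsf G$ is a directed acyclic graph with vertex set $\mathcal V$; $\mathcal F=(F_V)_{V\in\mathcal V}$ where, with $p(V)$ the set of parents of $V$ in $\mathsf G$, $F_V:\prod_{U\in\mathcal U\cup p(V)}\mathcal R(U)\to\mathcal R(V)$; and $\vec u$ (the context) gives each $U\in\mathcal U$ a value in $\mathcal R(U)$. By acyclicity the system of equations ''$V=F_V(\ldots)$ for all $V\in\mathcal V$'', with exogenous values given by $\vec u$, has a unique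 solution $S_M$. Basic formulas: Boolean combinations of atoms $(V=v)$ with $V\in\mathcal V$, $v\in\mathcal R(V)$. $M\models(V=v)$ iff $S_M(V)=v$; Boolean connectives are interpreted as usual. Interventions: for $\vec X\subseteq\mathcal V$ and an assignment $\vec x$ of range-permitted values to $\vec X$, $M_{[\vec X\leftarrow\vec x]}$ is the model obtained from $M$ by replacing $F_{X_i}$ by the constant $x_i$ for every $X_i\in\vec X$. If $\vec x$ is a partial assignment on $\vec X$, variables of $\vec X$ with no value in $\vec x$ keep their equations. $M\models[\vec X\leftarrow\vec x]\phi$ means $M_{[\vec X\leftarrow\vec x]}\models\phi$. Causal theory: a map $\mathsf{Cause}$ with $\mathsf{Cause}(M,\phi)\subseteq\mathcal V$ for all models $M$ and basic formulas $\phi$ over $\mathcal S$. But-for theory: $X\in\mathsf{ButFor}(M,\phi)$ iff $M\models\phi$ and there is $x\in\mathcal R(X)$ with $M\models[X\leftarrow x]\neg\phi$. The 2005 theory: $\vec X\subseteq\mathcal V$, with actual values $\vec x$ (i.e. $M\models(\vec X=\vec x)$), is a 2005-cause of $\phi$ in $M$ if (AC1) $M\models\phi$; (AC2) there are a partition of $\mathcal V$ into two sets $\vec Z,\vec W$ with $\vec X\subseteq\vec Z$ and settings $\vec x'$ for $\vec X$ and $\vec w'$ for $\vec W$ such that (a) $M\models[\vec X\leftarrow\vec x',\vec W\leftarrow\vec w']\neg\phi$, and (b) (invariance constraint) for all $\vec W'\subseteq\vec W$ and all $\vec Z'\subseteq\vec Z$, $M\models[\vec X\leftarrow\vec x,\vec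 W'\leftarrow\vec w',\vec Z'\leftarrow\vec z^*]\phi$, where $\vec w'$ is restricted to $\vec W'$ and $\vec z^*$ are the actual values of $\vec Z'$ in $M$; (AC3) no proper subset of $\vec X$ satisfies AC1 and AC2. Then $\mathsf{HP}_{2005}(M,\phi)=\{V\in\mathcal V\mid V\in\vec X\text{ for some 2005-cause }\vec X\text{ of }\phi\text{ in }M\}$. Counterfactual models: for $\vec X\subseteq\mathcal V$ with complement $c(\vec X)=\mathcal V\setminus\vec X$, $\mathcal M(\vec X)$ is the set of all models $M_{[\vec X\leftarrow\vec v,\,c(\vec X)\leftarrow\vec w]}$ where $\vec v$ is any partial assignment of range-permitted values to $\vec X$ and $\vec w$ is any partial assignment to $c(\vec X)$ consisting of actual values (each $w_i\in\vec w$ for $W_i$ satisfies $M\models(W_i=w_i)$). Relative to a causal theory $\mathsf{Cause}$: $V$ is a putative cause of $\phi$ in $M$ if there is $M'\in\mathcal M(\mathsf{Cause}(M,\phi))$ with $S_M(V)=S_{M'}(V)$ and $V\in\mathsf{ButFor}(M',\phi)$. $V$ is a preempted cause of $\phi$ in $M$ if it is a putative cause of $\phi$ in $M$ but $V\notin\mathsf{Cause}(M,\phi)$. Principle of presumption: $\mathsf{Cause}$ satisfies it if for all $M,\phi,V$ the following condition holds: if $V$ is a preempted cause of $\phi$ in $M$, then for all $M'\in\mathcal M(\mathsf{Cause}(M,\phi))$ such that $S_{M'}(V)=S_M(V)$ and $V\in\mathsf{ButFor}(M',\phi)$, there is $W\in\mathcal V\setminus\mathsf{Cause}(M,\phi)$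 such that $S_M(W)\neq S_{M'}(W)$. *)

(* Defs.v *)
From HB Require Import structures.
From mathcomp Require Import all_boot boolp.

Set Implicit Arguments.
Unset Strict Implicit.
Unset Printing Implicit Defensive.

Record causal_structure := CausalStructure {
  exo : finType;
  endo : finType;
  exo_range : exo -> finType;
  endo_range : endo -> finType }.

Definition context (S : causal_structure) := forall U : exo S, exo_range U.

Definition assignment (S : causal_structure) := forall V : endo S, endo_range V.

(* [None] means that the variable is left unassigned. *)
Definition passignment (S : causal_structure) :=
  forall V : endo S, option (endo_range V).

Definition acyclic (T : eqType) (e : rel T) : Prop :=
  forall c : seq T, cycle e c -> c = [::].

Record model (S : causal_structure) := Model {
  edge : rel (endo S);
  edge_acyclic : acyclic edge;
  equation : forall V : endo S,
    context S -> (forall P : {P : endo S | edge P V}, endo_range (val P)) ->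
    endo_range V;
  ctx : context S }.

Section Solution.
Variables (S : causal_structure) (M : model S).

Definition is_solution (s : assignment S) : Prop :=
  forall V : endo S,
    s V = equation (ctx M) (fun P : {P : endo S | edge M P V} => s (val P)).

Lemma edge_wf : well_founded (fun P V : endo S => edge M P V).
Proof.
pose anc (V : endo S) := [set P | connect (edge M) P V].
suff H n V : #|anc V| <= n -> Acc (fun P V => edge M P V) V.
  by move=> V; exact: (H _ V (leqnn _)).
elim: n V => [|n IHn] V.
  by rewrite leqn0 cards_eq0 => /eqP/setP/(_ V); rewrite !inE connect0.
move=> leVn; constructor=> P ePV; apply: IHn; rewrite -ltnS.
apply: leq_trans leVn; apply: proper_card; apply/properP; split.
  apply/subsetP=> Q; rewrite !inE => cQP.
  by apply: connect_trans cQP _; exact: connect1.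
exists V; rewrite !inE ?connect0 //; apply/negP => /connectP[p pVp lastp].
have /edge_acyclic : cycle (edge M) (V :: p) by rewrite /= rcons_path pVp -lastp.
by [].
Qed.

Definition solution : assignment S :=
  Fix edge_wf (fun V => endo_range V)
    (fun V rec => equation (ctx M)
       (fun P : {P : endo S | edge M P V} => rec (val P) (valP P))).

Lemma solutionP : is_solution solution.
Proof.
move=> V; rewrite /solution Fix_eq // => W f g fg.
by congr equation; apply: functional_extensionality_dep => P; exact: fg.
Qed.

Lemma solution_unique (s : assignment S) : is_solution s -> s = solution.
Proof.
move=> sP; apply: functional_extensionality_dep => V.
elim/(well_founded_ind edge_wf): V => V IH; rewrite sP solutionP.
by congr equation; apply: functional_extensionality_dep => P; exact: IH (valP P).
Qed.

End Solution.

Inductive formula (S : causal_structure) : Type :=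
  | Atom (V : endo S) (v : endo_range V)
  | Not of formula S
  | And of formula S & formula S
  | Or of formula S & formula S.

Fixpoint holds (S : causal_structure) (s : assignment S) (phi : formula S) :
    bool :=
  match phi with
  | Atom V v => s V == v
  | Not p => ~~ holds s p
  | And p q => holds s p && holds s q
  | Or p q => holds s p || holds s q
  end.

Definition sat (S : causal_structure) (M : model S) (phi : formula S) : bool :=
  holds (solution M) phi.

(* The graph is kept: an intervened equation is a constant function of the same
   parents. *)
Definition intervene (S : causal_structure) (M : model S) (a : passignment S) :
    model S :=
  @Model S (edge M) (@edge_acyclic S M)
    (fun V c pa => if a V is Some x then x else equation c pa)
    (ctx M).

Definition single (S : causal_structure) (X : endo S) (x : endo_range X) :
    passignment S :=
  dfwith (fun V : endo S => @None (endo_range V)) (Some x).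

Definition restrict (S : causal_structure) (X : {set endo S})
    (s : assignment S) : passignment S :=
  fun V => if V \in X then Some (s V) else None.

(* Left-biased, but only used on assignments that agree where both are
   defined. *)
Definition merge (S : causal_structure) (a b : passignment S) : passignment S :=
  fun V => if a V is Some x then Some x else b V.

Definition pdom (S : causal_structure) (a : passignment S) : {set endo S} :=
  [set V | isSome (a V)].

Definition causal_theory (S : causal_structure) :=
  model S -> formula S -> {set endo S}.

Definition ButFor (S : causal_structure) : causal_theory S := fun M phi =>
  [set X | sat M phi &&
     [exists x : endo_range X, sat (intervene M (single x)) (Not phi)]].

(* A setting of a set of variables is given as a total assignment, of which only
   the restriction to that set is used. *)
Definition AC2_2005 (S : causal_structure) (M : model S) (phi : formula S)
    (X : {set endo S}) : Prop :=
  exists (Z W : {set endo S}) (x' w' : assignment S),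
    [/\ Z :|: W = [set: endo S], Z :&: W = set0, X \subset Z,
        sat (intervene M (merge (restrict X x') (restrict W w'))) (Not phi)
      & forall W' Z' : {set endo S}, W' \subset W -> Z' \subset Z ->
          sat (intervene M
                 (merge (restrict X (solution M))
                    (merge (restrict W' w') (restrict Z' (solution M)))))
              phi].

Definition cause_2005 (S : causal_structure) (M : model S) (phi : formula S)
    (X : {set endo S}) : Prop :=
  [/\ sat M phi, AC2_2005 M phi X
    & forall Y : {set endo S}, Y \proper X -> ~ (sat M phi /\ AC2_2005 M phi Y)].

Definition HP2005 (S : causal_structure) : causal_theory S := fun M phi =>
  [set V | `[< exists X : {set endo S}, V \in X /\ cause_2005 M phi X >]].

Definition counterfactual_model (S : causal_structure) (M : model S)
    (X : {set endo S}) (M' : model S) : Prop :=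
  exists v w : passignment S,
    [/\ pdom v \subset X, pdom w \subset ~: X,
        forall W (x : endo_range W), w W = Some x -> sat M (Atom x)
      & M' = intervene M (merge v w)].

Section Presumption.
Variables (S : causal_structure) (Cause : causal_theory S).

Definition putative_cause (M : model S) (phi : formula S) (V : endo S) : Prop :=
  exists M' : model S,
    [/\ counterfactual_model M (Cause M phi) M',
        solution M V = solution M' V & V \in ButFor M' phi].

Definition preempted_cause (M : model S) (phi : formula S) (V : endo S) : Prop :=
  putative_cause M phi V /\ V \notin Cause M phi.

Definition presumption_condition (M : model S) (phi : formula S) (V : endo S) :
    Prop :=
  preempted_cause M phi V ->
  forall M' : model S, counterfactual_model M (Cause M phi) M' ->
    solution M' V = solution M V -> V \in ButFor M' phi ->
  exists2 W : endo S, W \notin Cause M phi & solution M W <> solution M' W.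

Definition presumption : Prop :=
  forall (M : model S) (phi : formula S) (V : endo S),
    presumption_condition M phi V.

End Presumption.

Inductive ex_exo := U1 | U2 | U3.
Inductive ex_endo := J1 | J2 | J3 | B.

Definition ex_exo_code (x : ex_exo) : 'I_3 :=
  match x with
  | U1 => @Ordinal 3 0 isT
  | U2 => @Ordinal 3 1 isT
  | U3 => @Ordinal 3 2 isT
  end.
Definition ex_exo_decode (i : 'I_3) : ex_exo :=
  match val i with 0 => U1 | 1 => U2 | _ => U3 end.
Lemma ex_exo_codeK : cancel ex_exo_code ex_exo_decode.
Proof. by case. Qed.
HB.instance Definition _ := Finite.copy ex_exo (can_type ex_exo_codeK).

Definition ex_endo_code (x : ex_endo) : 'I_4 :=
  match x with
  | J1 => @Ordinal 4 0 isT
  | J2 => @Ordinal 4 1 isT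
  | J3 => @Ordinal 4 2 isT
  | B => @Ordinal 4 3 isT
  end.
Definition ex_endo_decode (i : 'I_4) : ex_endo :=
  match val i with 0 => J1 | 1 => J2 | 2 => J3 | _ => B end.
Lemma ex_endo_codeK : cancel ex_endo_code ex_endo_decode.
Proof. by case. Qed.
HB.instance Definition _ := Finite.copy ex_endo (can_type ex_endo_codeK).

Definition ex_structure : causal_structure :=
  @CausalStructure ex_exo ex_endo (fun=> 'I_2) (fun=> 'I_2).

Definition ex_edge (P V : ex_endo) : bool :=
  match P, V with
  | J1, B | J2, B | J3, B => true
  | _, _ => false
  end.

Lemma ex_edge_acyclic : acyclic ex_edge.
Proof.
case=> [//|x [|y p]] /=; first by case: x.
by case: x; case: y => //=; case: p => [|z p] //=; case: z.
Qed.

Definition ex_equation (V : ex_endo) (u : ex_exo -> 'I_2) :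
    ({P : ex_endo | ex_edge P V} -> 'I_2) -> 'I_2 :=
  match V return ({P : ex_endo | ex_edge P V} -> 'I_2) -> 'I_2 with
  | J1 => fun=> u U1
  | J2 => fun=> u U2
  | J3 => fun=> u U3
  | B => fun pa =>
      let j1 := pa (exist _ J1 isT) in
      let j2 := pa (exist _ J2 isT) in
      let j3 := pa (exist _ J3 isT) in
      if j2 == j3 then inord (1 - maxn j1 j2) else inord 1
  end.

Definition ex_model : model ex_structure :=
  @Model ex_structure ex_edge ex_edge_acyclic ex_equation (fun=> inord 1).

Definition ex_formula : formula ex_structure :=
  @Atom ex_structure B (inord 0).

(* Main.v *)
(** In [ex_model] the causes of [B = 0] under the 2005 theory are exactly [J2],
    [J3] and [B]. Each of these is a but-for cause, and a but-for cause always
    forms a singleton 2005-cause. By minimality, [J1] could then only be a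
    2005-cause as the singleton [{J1}]; falsifying [B = 0] would require
    changing [J2] and [J3] (or [B]) in [W], but changing any one of them alone
    already gives [B = 1] and so breaks the invariance constraint. Intervening
    on the causes by [J2 = J3 = 0] makes [J1] a but-for cause with its actual
    value, so [J1] is preempted, yet [J1] itself is the only variable outside
    the causes and its value is unchanged. *)
From mathcomp Require Import all_boot boolp.
Require Import Defs.

Set Implicit Arguments.
Unset Strict Implicit.
Unset Printing Implicit Defensive.

Section ButForCauses.
Variables (S : causal_structure) (M : model S).

(** The actual solution still solves the modified equations, so uniqueness applies. *)
Lemma solution_intervene_actual (a : passignment S) :
  (forall V x, a V = Some x -> x = solution M V) ->
  solution (intervene M a) = solution M.
Proof.
move=> aM; apply/esym/solution_unique => V /=.
by case aV: (a V) => [x|]; [rewrite (aM _ _ aV) | exact: solutionP].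
Qed.

Lemma sat_Not (phi : formula S) : sat M (Not phi) = ~~ sat M phi.
Proof. by []. Qed.

Lemma single_eq (X : endo S) (x : endo_range X) : single x X = Some x.
Proof. by rewrite /single dfwith_in. Qed.

Lemma single_neq (X V : endo S) (x : endo_range X) :
  V != X -> single x V = None.
Proof. by move=> neVX; rewrite /single dfwith_out // eq_sym. Qed.

(** For empty [X], the invariance constraint at [W' = W], [Z' = set0] concerns the very intervention
    that must falsify [phi]. *)
Lemma AC2_2005_set0 (phi : formula S) : ~ AC2_2005 M phi set0.
Proof.
case=> Z [W] [x'] [w'] [_ _ _ /negP nphi /(_ W set0 (subxx _) (sub0set _))].
move=> phiW; apply: nphi; move: phiW; rewrite /sat.
congr (is_true (holds (solution (intervene M _)) phi)).
apply: functional_extensionality_dep => V.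
by rewrite /merge /restrict !inE; case: ifP.
Qed.

Lemma AC2_2005_ButFor (phi : formula S) X :
  X \in ButFor M phi -> AC2_2005 M phi [set X].
Proof.
rewrite inE => /andP[phiM /existsP[x nphi]].
(* With [W] empty, falsifying [phi] is the but-for test; all values imposed in the invariance
   constraint are actual. *)
exists setT, set0, (dfwith (solution M) x), (solution M).
split; rewrite ?setU0 ?setI0 ?subsetT //.
  rewrite -[X in intervene M X](_ : single x = _) //.
  apply: functional_extensionality_dep => V; rewrite /merge /restrict !inE.
  by have [->|neVX] := eqVneq V X; rewrite ?single_eq ?dfwith_in // single_neq.
move=> W' Z' _ _; rewrite /sat solution_intervene_actual // => V y.
by rewrite /merge /restrict; do 3?case: ifP => _; case.
Qed.

Lemma cause_2005_ButFor (phi : formula S) (X : {set endo S}) V :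
  cause_2005 M phi X -> V \in X -> V \in ButFor M phi -> X = [set V].
Proof.
move=> [phiM _ minX] VX bfV; apply/eqP/negPn/negP => neX.
apply: (minX [set V]); last by split; last exact: AC2_2005_ButFor.
by rewrite properEneq eq_sym neX sub1set.
Qed.

(** Minimality of [[set V]] is automatic: its only proper subset is empty, which fails AC2. *)
Lemma ButFor_sub_HP2005 (phi : formula S) : ButFor M phi \subset HP2005 M phi.
Proof.
apply/subsetP => V bfV; rewrite inE; apply/asboolP; exists [set V].
split; first exact: set11; split; last 1 first.
- move=> Y; rewrite properEneq subset1 => /andP[/negPf-> /= /eqP->] [_].
  exact: AC2_2005_set0.
- by move: bfV; rewrite inE => /andP[].
- exact: AC2_2005_ButFor.
Qed.

End ButForCauses.

Lemma ex_solutionE (a : passignment ex_structure) (V : endo ex_structure) :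
  V != B -> solution (intervene ex_model a) V = odflt (inord 1) (a V).
Proof.
by rewrite (solutionP (intervene ex_model a)) /=; case: V => // _; case: (a _).
Qed.

(** Unless [B] is set directly, it is 0 iff [J2] and [J3] agree and [J1] or [J2] is 1; the default
    [inord 1] is the context value. *)
Lemma ex_satE (a : passignment ex_structure) :
  sat (intervene ex_model a) ex_formula =
  if a B is Some b then b == inord 0 else
  (odflt (inord 1) (a J2) == odflt (inord 1) (a J3)) &&
  ((odflt (inord 1) (a J1) == inord 1) || (odflt (inord 1) (a J2) == inord 1)).
Proof.
rewrite /sat /= (solutionP (intervene ex_model a)) /=.
case: (a B) => [b //|]; rewrite !ex_solutionE //.
move: (odflt _ (a J1)) (odflt _ (a J2)) (odflt _ (a J3)).
by do 3 ![case; case=> [|[|//]] ?]; rewrite -!val_eqE /= /maxn /= ?inordK.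
Qed.

Lemma ex_model_intervene0 : ex_model = intervene ex_model (fun=> None).
Proof. by []. Qed.

Lemma inord2_neq01 : (inord 0 == inord 1 :> 'I_2) = false.
Proof. by rewrite -val_eqE /= !inordK. Qed.

Lemma ex_sat : sat ex_model ex_formula.
Proof. by rewrite ex_model_intervene0 ex_satE /= eqxx. Qed.

Lemma ex_singleE (X V : endo ex_structure) (x : 'I_2) :
  @single ex_structure X x V = if V == X then Some x else None.
Proof. by have [->|neVX] := eqVneq V X; rewrite ?single_eq ?single_neq. Qed.

Lemma ex_ButFor V : V != J1 -> V \in ButFor ex_model ex_formula.
Proof.
move=> VJ1; rewrite inE ex_sat /=; apply/existsP; case: V VJ1 => // _.
- exists (inord 0); rewrite sat_Not ex_satE.
  by rewrite !ex_singleE /= inord2_neq01.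
- exists (inord 0); rewrite sat_Not ex_satE.
  by rewrite !ex_singleE /= eq_sym inord2_neq01.
- exists (inord 1); rewrite sat_Not ex_satE.
  by rewrite !ex_singleE /= eq_sym inord2_neq01.
Qed.

Lemma ex_solution V : V != B -> solution ex_model V = inord 1.
Proof. by move=> VB; rewrite ex_model_intervene0 ex_solutionE. Qed.

Lemma ex_J1_not_HP2005 : J1 \notin HP2005 ex_model ex_formula.
Proof.
rewrite inE; apply/asboolP => -[X [XJ1 causeX]].
(* Any other member of [X] is a but-for cause, so [X] would be its singleton and miss [J1]. *)
have XE V : V \in X -> V = J1.
  move=> VX; apply/eqP/negPn/negP => VJ1; move: XJ1.
  rewrite (cause_2005_ButFor causeX VX (ex_ButFor VJ1)) inE eq_sym.
  exact/negP.
have XB : (B \in X) = false by apply/negP => /XE.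
have X2 : (J2 \in X) = false by apply/negP => /XE.
have X3 : (J3 \in X) = false by apply/negP => /XE.
case: causeX => _ [Z] [W] [x'] [w'] [_ _ _]; rewrite sat_Not.
move=> /negP nphi inv _; apply: nphi.
(* Invariance is used only for one variable of [W] at a time; this forces [w'] to be actual at [B],
   [J2] and [J3]. *)
have {}inv V (VW : V \in W) :=
  inv [set V] set0 (etrans (sub1set _ _) VW) (sub0set Z).
rewrite ex_satE /merge /restrict XB X2 X3.
have WB : B \in W -> w' B = inord 0.
  by move=> /inv; rewrite ex_satE /merge /restrict XB !inE eqxx => /eqP.
have W2 : J2 \in W -> w' J2 = inord 1.
  move=> /inv; rewrite ex_satE /merge /restrict XB X2 X3 !inE /=.
  by case/andP=> /eqP.
have W3 : J3 \in W -> w' J3 = inord 1.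
  move=> /inv; rewrite ex_satE /merge /restrict XB X2 X3 !inE /=.
  by case/andP=> /eqP.
(* If [B] is not in [W], then [J2 = J3 = 1], which gives [B = 0] for either value of [J1]. *)
case: ifP => [/WB-> //|_]; rewrite XJ1.
have -> : odflt (inord 1) (if J2 \in W then Some (w' J2) else None) = inord 1.
  by case: ifP => // /W2.
have -> : odflt (inord 1) (if J3 \in W then Some (w' J3) else None) = inord 1.
  by case: ifP => // /W3.
by rewrite !eqxx orbT.
Qed.

Lemma ex_HP2005 V : (V \in HP2005 ex_model ex_formula) = (V != J1).
Proof.
have [->|VJ1] := eqVneq V J1; first exact/negbTE/ex_J1_not_HP2005.
exact: (subsetP (ButFor_sub_HP2005 _ _)) (ex_ButFor VJ1).
Qed.

(** Under [J2 = J3 = 0] the equation of [B] becomes [B = 1 - J1]. *)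
Definition ex_zero_assignment : passignment ex_structure :=
  fun V => if (V == J2) || (V == J3) then Some (inord 0) else None.

Lemma ex_counterfactual :
  counterfactual_model ex_model (HP2005 ex_model ex_formula)
    (intervene ex_model ex_zero_assignment).
Proof.
exists ex_zero_assignment, (fun=> None); split=> //.
- by apply/subsetP => -[]; rewrite inE ex_HP2005.
- by apply/subsetP => V; rewrite inE.
- congr intervene; apply: functional_extensionality_dep => V.
  by rewrite /merge; case: (ex_zero_assignment V).
Qed.

(** The later intervention overrides the earlier one, hence [b] on the left of the left-biased
    [merge]. *)
Lemma intervene2 (S : causal_structure) (M : model S) (a b : passignment S) :
  intervene (intervene M a) b = intervene M (merge b a).
Proof.
congr Model; apply: functional_extensionality_dep => V.
apply/funext => c; apply/funext => pa.
by rewrite /merge; case: (b V).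
Qed.

Lemma ex_counterfactual_ButFor :
  J1 \in ButFor (intervene ex_model ex_zero_assignment) ex_formula.
Proof.
rewrite inE; apply/andP; split; first by rewrite ex_satE /= !eqxx.
apply/existsP; exists (inord 0).
rewrite sat_Not intervene2 ex_satE /merge.
by rewrite !ex_singleE /= inord2_neq01 andbF.
Qed.

Theorem mainTheorem4 :
  ~ presumption (@HP2005 ex_structure) /\
  ~ presumption_condition (@HP2005 ex_structure) ex_model ex_formula J1.
Proof.
have nJ1 :
  ~ presumption_condition (@HP2005 ex_structure) ex_model ex_formula J1.
  have J1E : solution (intervene ex_model ex_zero_assignment) J1 =
             solution ex_model J1 by rewrite ex_solutionE // ex_solution.
  have J1P : preempted_cause (@HP2005 ex_structure) ex_model ex_formula J1.
    split; last exact: ex_J1_not_HP2005.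
    exists (intervene ex_model ex_zero_assignment); split => //.
    - exact: ex_counterfactual.
    - exact: ex_counterfactual_ButFor.
  case/(_ J1P _ ex_counterfactual J1E ex_counterfactual_ButFor) => W.
  by rewrite ex_HP2005 negbK => /eqP->; rewrite J1E.
by split=> [presHP|]; [exact: nJ1 (presHP _ _ _) | exact: nJ1].
Qed.
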